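(* Let $n\ge1$ and let $\beta\in B_n$ be an arbitrary braid, with Laurent MFW polynomials $h_j$, let $m$ and $M$ be the minimal and maximal indices $j$ with $h_j\ne0$, and let $x=\min\deg_v P_{\widehat\beta}$. If $M\ge m+2$, then (i) $h_m=z^{-2}\bigl\{C_{x+3}-\nabla_{\widehat\beta}-\sum_{j=3}^{M-m}(C_{2j-3}-1)\,h_{m+j}\bigr\}$; (ii) $h_{m+1}=\nabla_{\widehat\beta}-h_m-h_{m+2}-\sum_{j=3}^{M-m}h_{m+j}$; (iii) $h_{m+2}=z^{-2}\bigl\{C_{x+1}-\nabla_{\widehat\beta}-\sum_{j=3}^{M-m}(C_{2j-1}-1)\,h_{m+j}\bigr\}$. If $M<m+2$, the same holds with $h_{m+2}$ replaced by $0$ in (iii). If $M=m$, then $P_{\widehat\beta}=1$. If $M=m+1$, then $P_{\widehat\beta}=v^{x}\,(C_{x+2}-v^2C_{x})/z$.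
   Context: $B_n$ is the braid group on $n$ strands with standard generators $\sigma_1,\dots,\sigma_{n-1}$; $\widehat\beta$ is the oriented link obtained by the standard closure of $\beta$; $w=w(\beta)$ is the exponent sum (writhe) of $\beta$. The Homflypt polynomial $P_L(v,z)$ of an oriented link $L$ is determined by $P=1$ on the unknot and $P_{D_+}=vz\,P_{D_0}+v^2P_{D_-}$ for diagrams differing at one crossing (positive, smoothed, negative). The Conway polynomial is $\nabla_L(z)=P_L(1,z)$. For every integer $p$, $C_p=C_p(z)$ is the Conway polynomial of the closure of $\sigma_1^p\in B_2$; equivalently $C_0=0$, $C_1=1$, $C_{p+1}=zC_p+C_{p-1}$ for all $p\in\mathbb Z$. For $\beta\in B_n$ one can write uniquely $P_{\widehat\beta}(v,z)=v^{w-n+1}\sum_{j=0}^{n-1}h_j(z)v^{2j}$ with $h_j\in\mathbb Z[z,z^{-1}]$ (a consequence of the Morton-Franks-Williams inequality); the $h_j$ (possibly zero) are the Laurent MFW polynomials of $\beta$; $h_j$ with $j\ge n$ is read as $0$. $\min\deg_v P$ is the smallest power of $v$ occurring in $P$; here $x=w-n+1+2m$. Empty sums are $0$. *)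

(* Defs.v *)
From HB Require Import structures.
From mathcomp Require Import all_boot all_order all_algebra finmap.
From mathcomp Require Import monalg.
From mathcomp Require Import zify ring.

Set Implicit Arguments.
Unset Strict Implicit.
Unset Printing Implicit Defensive.

Import Order.TTheory GRing.Theory Num.Theory.
Local Open Scope fset_scope.
Local Open Scope ring_scope.

(* R[X, X^-1] is the monoid algebra of (int, +).  monalg supplies its module
   structure for any set of exponents, but its product only for monoids without
   units other than 1, which excludes int; hence the ring structure below. *)

Definition laurent (R : comNzRingType) : Type := {malg R[int]}.

Section LaurentRing.
Variable R : comNzRingType.

HB.instance Definition _ := GRing.Lmodule.on (laurent R).

Implicit Types (f g : laurent R) (k l : int).

Definition laurent_monomial (c : R) k : laurent R := << c *g k >>.

Local Notation mono := laurent_monomial.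

Definition laurent_one : laurent R := mono 1 0.

Definition laurent_mul f g : laurent R :=
  \sum_(k <- msupp f) \sum_(l <- msupp g) mono (f@_k * g@_l) (k + l).

Lemma monoD a b k : mono (a + b) k = mono a k + mono b k.
Proof. exact: monalgUD. Qed.

Lemma mono0 k : mono 0 k = 0.
Proof. exact: monalgU0. Qed.

Lemma laurent_mulEw (d1 d2 : {fset int}) f g :
  msupp f `<=` d1 -> msupp g `<=` d2 ->
  laurent_mul f g =
    \sum_(k <- d1) \sum_(l <- d2) mono (f@_k * g@_l) (k + l).
Proof.
move=> le1 le2; rewrite /laurent_mul (big_fset_incl _ le1) /=.
  apply: eq_bigr => k _; apply: big_fset_incl => // l _ /mcoeff_outdom ->.
  by rewrite mulr0 mono0.
move=> k _ /mcoeff_outdom fk0.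
by rewrite big1 // => l _; rewrite fk0 mul0r mono0.
Qed.

Lemma laurent_mulC : commutative laurent_mul.
Proof.
move=> f g; rewrite /laurent_mul exchange_big /=.
by do 2 (apply: eq_bigr => ? _); rewrite mulrC addrC.
Qed.

Lemma laurent_mul0g : left_zero 0 laurent_mul.
Proof. by move=> g; rewrite /laurent_mul msupp0 big_seq_fset0. Qed.

Lemma laurent_mulDl : left_distributive laurent_mul +%R.
Proof.
move=> f1 f2 g.
rewrite (laurent_mulEw (msuppD_le _ _) (fsubset_refl (msupp g))).
rewrite (laurent_mulEw (fsubsetUl (msupp f1) (msupp f2)) (fsubset_refl (msupp g))).
rewrite (laurent_mulEw (fsubsetUr (msupp f1) (msupp f2)) (fsubset_refl (msupp g))).
rewrite -big_split /=; apply: eq_bigr => k _.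
rewrite -big_split /=; apply: eq_bigr => l _.
by rewrite mcoeffD mulrDl monoD.
Qed.

Lemma laurent_mulUU a b k l :
  laurent_mul (mono a k) (mono b l) = mono (a * b) (k + l).
Proof.
by rewrite (laurent_mulEw msuppU_le msuppU_le) !big_seq_fset1 !mcoeffUU.
Qed.

Lemma laurent_mulDr : right_distributive laurent_mul +%R.
Proof. by move=> f g1 g2; rewrite !(laurent_mulC f) laurent_mulDl. Qed.

Lemma laurent_mulg0 : right_zero 0 laurent_mul.
Proof. by move=> f; rewrite laurent_mulC laurent_mul0g. Qed.

Lemma laurentE f : f = \sum_(k <- msupp f) mono f@_k k.
Proof. exact: monalgE. Qed.

Lemma laurent_ind (Q : laurent R -> Prop) :
  Q 0 -> (forall f g, Q f -> Q g -> Q (f + g)) -> (forall c k, Q (mono c k)) ->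
  forall f, Q f.
Proof. by move=> Q0 QD Qm f; rewrite (laurentE f); apply: big_ind. Qed.

Lemma laurent_mulA : associative laurent_mul.
Proof.
move=> f g h; elim/laurent_ind: f => [|f1 f2 e1 e2|a k].
- by rewrite !laurent_mul0g.
- by rewrite !laurent_mulDl e1 e2.
elim/laurent_ind: g => [|g1 g2 e1 e2|b l].
- by rewrite laurent_mul0g !laurent_mulg0 laurent_mul0g.
- by rewrite laurent_mulDl !laurent_mulDr laurent_mulDl e1 e2.
elim/laurent_ind: h => [|h1 h2 e1 e2|c p].
- by rewrite !laurent_mulg0.
- by rewrite !laurent_mulDr e1 e2.
by rewrite !laurent_mulUU mulrA addrA.
Qed.

Lemma laurent_mul1g : left_id laurent_one laurent_mul.
Proof.
elim/laurent_ind => [|f1 f2 e1 e2|a k]; first exact: laurent_mulg0.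
  by rewrite laurent_mulDr e1 e2.
by rewrite laurent_mulUU mul1r add0r.
Qed.

Lemma laurent_one_neq0 : laurent_one != 0.
Proof.
apply/eqP => /(congr1 (fun f : laurent R => f@_0)).
by rewrite mcoeffUU mcoeff0 => /eqP; rewrite oner_eq0.
Qed.

HB.instance Definition _ := GRing.Zmodule_isComNzRing.Build (laurent R)
  laurent_mulA laurent_mulC laurent_mul1g laurent_mulDl laurent_one_neq0.

Lemma monoM a b k l : mono a k * mono b l = mono (a * b) (k + l).
Proof. exact: laurent_mulUU. Qed.

(* evaluation at X = 1 *)
Definition laurent_at1 f : R := \sum_(k <- msupp f) f@_k.

Definition is_mindeg f k :=
  k \in msupp f /\ forall l, l \in msupp f -> k <= l.

End LaurentRing.

Notation "c %:L" := (laurent_monomial c 0) (at level 1, left associativity, format "c %:L").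

(* Z[z, z^-1] and Z[v, v^-1, z, z^-1] *)
Notation Lz := (laurent int).
Notation Lvz := (laurent (laurent int)).

Definition zpow (k : int) : Lz := laurent_monomial 1 k.
Definition vpow (k : int) : Lvz := laurent_monomial 1 k.

(* A link diagram is put in general position with respect to the height
   function of the plane and read from bottom to top as a sequence of
   elementary slices, a slice (i, k) having i strands to the left of the
   non-trivial piece k, which is a local minimum (Cup), a local maximum (Cap)
   or a crossing.  Strands are numbered from 0.
   - In Cup o, the left leg is oriented upwards iff o.
   - In Cross b, the strand going from bottom left to top right is the
     overcrossing one iff b. *)
Variant piece := Cup of bool | Cap | Cross of bool.
Definition slice := (nat * piece)%type.
Definition diagram := seq slice.

(* A horizontal level is the sequence of the strands that meet it, each being
   recorded as true if oriented upwards, and false otherwise. *)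
Definition level := seq bool.

Definition slice_step (s : level) (e : slice) : option level :=
  let: (i, k) := e in
  match k, drop i s with
  | Cup o, t => if (i <= size s)%N then Some (take i s ++ [:: o, ~~ o & t]) else None
  | Cap, [:: a, b & t] => if a != b then Some (take i s ++ t) else None
  | Cross _, [:: a, b & t] => Some (take i s ++ [:: b, a & t])
  | _, _ => None
  end.

Fixpoint run (s : level) (D : diagram) : option level :=
  if D is e :: D' then obind (run^~ D') (slice_step s e) else Some s.

Definition is_link_diagram (D : diagram) : Prop := run [::] D = Some [::].

Definition strands_in (k : piece) : nat := if k is Cup _ then 0 else 2.
Definition strands_out (k : piece) : nat := if k is Cap then 0 else 2.

(* Plane isotopy (the first five rules) and Reidemeister moves, for diagrams
   presented by slices. *)
Inductive local_move : diagram -> diagram -> Prop :=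
| move_exchange i d k l :
    local_move [:: (i, k); ((i + strands_out k + d)%N, l)]
               [:: ((i + strands_in k + d)%N, l); (i, k)]
| move_zigzagl i o : local_move [:: (i, Cup o); (i.+1, Cap)] [::]
| move_zigzagr i o : local_move [:: (i.+1, Cup o); (i, Cap)] [::]
| move_cup i o b :
    local_move [:: (i, Cup o); (i.+1, Cross b)]
               [:: (i.+1, Cup o); (i, Cross (~~ b))]
| move_cap i b :
    local_move [:: (i.+1, Cross b); (i, Cap)]
               [:: (i, Cross (~~ b)); (i.+1, Cap)]
| move_R1l i o b :
    local_move [:: (i, Cup o); (i.+1, Cross b); (i, Cap)] [::]
| move_R1r i o b :
    local_move [:: (i.+1, Cup o); (i, Cross b); (i.+1, Cap)] [::]
| move_R2 i b : local_move [:: (i, Cross b); (i, Cross (~~ b))] [::]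
(* the side condition says that the three strands are stacked *)
| move_R3 i b1 b2 b3 : (b1 == b2) || (b2 == b3) ->
    local_move [:: (i, Cross b1); (i.+1, Cross b2); (i, Cross b3)]
               [:: (i.+1, Cross b3); (i, Cross b2); (i.+1, Cross b1)].

(* The oriented smoothing of a crossing at position i whose bottom left and
   bottom right strands have orientations o1 and o2. *)
Definition smoothing (i : nat) (o1 o2 : bool) : diagram :=
  if o1 == o2 then [::] else [:: (i, Cap); (i, Cup o2)].

(* P is the Homflypt polynomial: an invariant of oriented links, normalized on
   the unknot and satisfying the skein relation.  Nothing is required of its
   values on sequences of slices that are not link diagrams.  The crossing
   Cross b with incoming orientations o1, o2 is positive iff b = (o1 == o2). *)
Record is_homflypt (P : diagram -> Lvz) : Prop := IsHomflypt {
  homflypt_invariant : forall A B D D', local_move D D' ->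
    is_link_diagram (A ++ D ++ B) -> is_link_diagram (A ++ D' ++ B) ->
    P (A ++ D ++ B) = P (A ++ D' ++ B);
  homflypt_unknot : forall o, P [:: (0, Cup o); (0, Cap)] = 1;
  homflypt_skein : forall A B i b s, run [::] A = Some s ->
    is_link_diagram (A ++ (i, Cross b) :: B) ->
    let o1 := nth false s i in
    let o2 := nth false s i.+1 in
    P (A ++ (i, Cross (o1 == o2)) :: B) =
      vpow 1 * (zpow 1)%:L * P (A ++ smoothing i o1 o2 ++ B)
      + vpow 2 * P (A ++ (i, Cross (o1 != o2)) :: B)
}.

Definition conway (P : diagram -> Lvz) (D : diagram) : Lz := laurent_at1 (P D).

(* A braid is given by a word in the standard generators and their inverses;
   (i, true) is sigma_(i+1), (i, false) its inverse. *)
Definition braid_word (n : nat) := seq ('I_n.-1 * bool).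

Definition writhe n (beta : braid_word n) : int :=
  \sum_(g <- beta) (if g.2 then 1 else -1).

Definition braid_closure n (beta : braid_word n) : diagram :=
  [seq (i, Cup true) | i <- iota 0 n] ++
  [seq (val g.1, Cross g.2) | g <- beta] ++
  rev [seq (i, Cap) | i <- iota 0 n].

(* The Laurent MFW polynomials h_j, i.e. the coefficients in
   P = v^(w-n+1) * \sum_(j < n) h_j v^(2j); see mfw_unique. *)
Definition mfw (P : diagram -> Lvz) n (beta : braid_word n) (j : nat) : Lz :=
  if (j < n)%N then
    (P (braid_closure beta))@_(writhe beta - n%:Z + 1 + 2 * j%:Z)
  else 0.

Definition is_min_index (h : nat -> Lz) (m : nat) :=
  h m != 0 /\ forall j, h j != 0 -> (m <= j)%N.

Definition is_max_index (h : nat -> Lz) (M : nat) :=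
  h M != 0 /\ forall j, h j != 0 -> (j <= M)%N.

Fixpoint Cpoly_nat (p : nat) : Lz :=
  match p with
  | 0 => 0
  | 1 => 1
  | (q.+1 as r).+1 => zpow 1 * Cpoly_nat r + Cpoly_nat q
  end.

(* C_(-p) = (-1)^(p-1) C_p *)
Definition Cpoly (p : int) : Lz :=
  match p with
  | Posz q => Cpoly_nat q
  | Negz q => (-1) ^+ q * Cpoly_nat q.+1
  end.

Lemma Cpoly0 : Cpoly 0 = 0. Proof. by []. Qed.

Lemma Cpoly1 : Cpoly 1 = 1. Proof. by []. Qed.

Lemma Cpoly_rec p : Cpoly (p + 1) = zpow 1 * Cpoly p + Cpoly (p - 1).
Proof.
case: p => [[|p]|p].
- by rewrite add0r sub0r /= mulr0 add0r expr0 mul1r.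
- have ->: Posz p.+1 + 1 = p.+2 by rewrite addrC -intS.
  by have ->: Posz p.+1 - 1 = p by rewrite intS addrAC subrr add0r.
- have ->: Negz p - 1 = Negz p.+1 by rewrite !NegzE (intS p.+1) opprD addrC.
  case: p => [|p].
    by rewrite NegzE addNr /= expr0 expr1 addr0; ring.
  have ->: Negz p.+1 + 1 = Negz p.
    by rewrite !NegzE (intS p.+1) opprD addrAC addNr add0r.
  by rewrite /Cpoly /= !exprS; ring.
Qed.

Lemma run_cat s D D' : run s (D ++ D') = obind (run^~ D') (run s D).
Proof. by elim: D s => //= e D IH s; case: (slice_step s e). Qed.

Lemma braid_closure_is_link_diagram n (beta : braid_word n) :
  is_link_diagram (braid_closure beta).
Proof.
have nseqSr k (x : bool) : nseq k.+1 x = rcons (nseq k x) x.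
  by elim: k => //= k ->.
have split_level k (t : seq bool) :
    drop k (nseq k true ++ t) = t /\ take k (nseq k true ++ t) = nseq k true.
  by rewrite drop_size_cat ?take_size_cat ?size_nseq.
have cups k : run [::] [seq (i, Cup true) | i <- iota 0 k]
    = Some (nseq k true ++ nseq k false).
  elim: k => // k IH; rewrite -[in iota _ _]addn1 iotaD map_cat run_cat IH /=.
  rewrite size_cat !size_nseq leq_addr.
  by have [-> ->] := split_level k (nseq k false); rewrite -cat_rcons -nseqSr.
have caps k : run (nseq k true ++ nseq k false)
    (rev [seq (i, Cap) | i <- iota 0 k]) = Some [::].
  elim: k => // k IH; rewrite -[in iota _ _]addn1 iotaD map_cat rev_cat /=.
  rewrite add0n -[true :: _]/(nseq k.+1 true ++ _) nseqSr cat_rcons.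
  by have [-> ->] := split_level k (true :: false :: nseq k false); rewrite /= IH.
rewrite /is_link_diagram /braid_closure !run_cat cups /= run_cat.
suff ->: run (nseq n true ++ nseq n false)
    [seq (val g.1, Cross g.2) | g <- beta] = Some (nseq n true ++ nseq n false).
  exact: caps.
elim: beta => // -[[i lti] b] beta IH.
have [d dE] : exists d, n = (i + d.+2)%N.
  by exists (n - i.+2)%N; move: lti; rewrite -ltnS; case: (n) => //= k; lia.
have e : nseq n true = nseq i true ++ true :: true :: nseq d true.
  by rewrite dE nseqD.
have E : slice_step (nseq n true ++ nseq n false) (i, Cross b)
    = Some (nseq n true ++ nseq n false).
  rewrite /slice_step e -catA.
  by have [-> ->] := split_level i ([:: true, true & nseq d true] ++ nseq n false).
by apply: etrans (congr1 (obind (run^~ _)) E) _; exact: IH.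
Qed.

(* The condition on h is the defining property of the Laurent MFW polynomials;
   the lemma says that it determines them. *)
Lemma mfw_unique (P : diagram -> Lvz) n (beta : braid_word n) (h : nat -> Lz) :
    P (braid_closure beta) = vpow (writhe beta - n%:Z + 1) *
      \sum_(j < n) (h j)%:L * vpow (2 * j%:Z) ->
  forall j, (j < n)%N -> mfw P beta j = h j.
Proof.
move=> PE j ltjn; rewrite /mfw ltjn PE mulr_sumr raddf_sum /=.
under eq_bigr => i _ do
  rewrite /vpow !monoM mul1r mulr1 add0r /laurent_monomial mcoeffU
    (inj_eq (addrI _)) (inj_eq (mulfI _)) // eqz_nat.
rewrite (bigD1 (Ordinal ltjn)) //= eqxx mulr1n big1 ?addr0 // => i ne_ij.
by rewrite (negbTE (_ : nat_of_ord i != j)).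
Qed.

(* Main.v *)
Require Import Defs.
From mathcomp Require Import all_boot all_order all_algebra finmap monalg.
From mathcomp Require Import zify ring.

Set Implicit Arguments.
Unset Strict Implicit.
Unset Printing Implicit Defensive.

Import Order.TTheory GRing.Theory Num.Theory.
Local Open Scope ring_scope.

(** Read in the quadratic extension of Z[z, 1/z] by u with u - 1/u = z, the
    skein relation at v = 1/u is solved by the constant 1, so P takes the value
    1 at v = 1/u on every braid closure.  Since u^k = C_k u + C_(k-1), this
    says that, for every k, sum_l P_l C_(k-l) = C_k, where P_l is the
    coefficient of v^l in P ([pairing] and the second half of [admissible]).
    Combined with P = sum_j h_j v^(x + 2(j - m)), the choices k = x + 3 and
    k = x + 1, together with the value nabla at v = 1, give three linear
    equations in h_m, h_(m+1), h_(m+2), and these are the three formulas,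
    because C_3 = C_(-3) = z^2 + 1 and C_1 = C_(-1) = 1.  The cases M = m and
    M = m + 1 come from the same equations with k = x, x + 1, x + 2
    ([mfw_formula_min] to [mfw_pair]).

    What has to be established for an arbitrary P satisfying the axioms is that
    every braid closure obeys the above specialization and that P has no
    coefficients besides the h_j, which is the Morton-Franks-Williams bound with
    its parity statement.  Both are properties of a skein triple of which any
    two members imply the third, both pass from n to n + 1 strands under
    stabilization, and both hold for the unknot.  So they follow from the
    spanning property H_(n+1) = H_n + H_n sigma_n H_n of the Hecke algebras,
    which [skein_reduction] states for braid words and an arbitrary
    skein-closed predicate: a word is reduced to words with at most one letter
    sigma_n.  With one letter sigma_n they are stabilizations after a
    conjugation; without it they are smoothings of two stabilizations.

    Invariance under conjugation ([conjugation]) and stabilization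
    ([stabilization]) is read off the slices: a crossing on top of the braid is
    carried through the nested caps to the closing strands on the right, slides
    down past the braid, and comes back through the nested cups. *)

(** * Coefficients and linear functionals of Laurent polynomials *)

Section LaurentFunctionals.
Variable R : comNzRingType.
Implicit Types (f g : laurent R) (a : R) (c : int -> R) (k l : int).

(** The functional sending X^k to c k.  Evaluations in a quadratic extension of R
    are handled through such functionals, one for each coordinate, so that the
    extension itself need not be built. *)
Definition pairing c f : R := \sum_(k <- msupp f) f@_k * c k.

Lemma pairing_mmap c f : pairing c f = mmap (idfun : {additive R -> R}) c f.
Proof. by []. Qed.

Lemma pairingD c : {morph pairing c : f g / f + g}.
Proof. by move=> f g; rewrite !pairing_mmap raddfD. Qed.

Lemma pairing0 c : pairing c 0 = 0.
Proof. by rewrite pairing_mmap raddf0. Qed.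

Lemma pairing_mono c a k : pairing c (laurent_monomial a k) = a * c k.
Proof. exact: (mmapU (f := (idfun : {additive R -> R}))). Qed.

Lemma pairing_monoM c a k f :
  pairing c (laurent_monomial a k * f) = a * pairing (fun l => c (k + l)) f.
Proof.
elim/laurent_ind: f => [|f g IHf IHg|b l].
- by rewrite mulr0 !pairing0 mulr0.
- by rewrite mulrDr !pairingD IHf IHg mulrDr.
by rewrite monoM !pairing_mono mulrA.
Qed.

Lemma eq_pairing c c' f : c =1 c' -> pairing c f = pairing c' f.
Proof. by move=> e; apply: eq_bigr => k _; rewrite e. Qed.

Lemma laurent_at1_pairing f : laurent_at1 f = pairing (fun=> 1) f.
Proof. by apply: eq_bigr => k _; rewrite mulr1. Qed.

Lemma mcoeff_monoE a k l : (laurent_monomial a k)@_l = a *+ (k == l).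
Proof. exact: mcoeffU. Qed.

Lemma mcoeff_monoM a k f l :
  (laurent_monomial a k * f)@_l = a * f@_(l - k).
Proof.
elim/laurent_ind: f => [|f g IHf IHg|b j].
- by rewrite mulr0 !mcoeff0 mulr0.
- by rewrite mulrDr !mcoeffD IHf IHg mulrDr.
rewrite monoM /laurent_monomial !mcoeffU mulrnAr.
by have -> // : (k + j == l) = (j == l - k) by rewrite eq_sym addrC -subr_eq eq_sym.
Qed.

End LaurentFunctionals.

Lemma zpowD k l : zpow (k + l) = zpow k * zpow l.
Proof. by rewrite /zpow monoM mulr1. Qed.

(** * Nonvanishing of the Conway polynomials C_k *)

Lemma Cpoly_coef q : (Cpoly (q.+1)%:Z)@_(q%:Z) = 1.
Proof.
suff [] : (Cpoly_nat q.+1)@_(q%:Z) = 1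
  /\ forall l : int, q%:Z < l -> (Cpoly_nat q.+1)@_l = 0 by [].
elim/ltn_ind: q => -[|[|q]] IH.
- split=> [|l l0]; first by rewrite [LHS]mcoeff_monoE eqxx.
  by rewrite [LHS]mcoeff_monoE; case: eqP l0 => // <-.
- have -> : Cpoly_nat 2 = zpow 1 by rewrite /= mulr1 addr0.
  split=> [|l l0]; first by rewrite [LHS]mcoeff_monoE eqxx.
  by rewrite [LHS]mcoeff_monoE; case: eqP l0 => // <-.
have [IH1 IH1'] := IH q.+1 (ltnSn _).
have [_ IH0'] := IH q (ltnW (ltnSn _)).
have -> : Cpoly_nat q.+3 = zpow 1 * Cpoly_nat q.+2 + Cpoly_nat q.+1 by [].
split=> [|l ltl]; rewrite mcoeffD mcoeff_monoM mul1r.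
  have -> : q.+2%:Z - 1 = q.+1 by lia.
  by rewrite IH1 IH0' ?addr0; lia.
by rewrite IH1' ?IH0' ?addr0; lia.
Qed.

Lemma Cpoly_eq0 k : Cpoly k = 0 -> k = 0.
Proof.
case: k => [[|q]|q] // C0.
  by have := Cpoly_coef q; rewrite C0 mcoeff0.
have E : Cpoly_nat q.+1 = 0 by rewrite -[LHS](signrMK q) [X in _ * X]C0 mulr0.
by have := Cpoly_coef q; rewrite /Cpoly E mcoeff0.
Qed.

(** * Skein reduction of braid words *)

(** Letters carry a plain natural number rather than an ordinal, so that a word
    on n strands is also one on n + 1 strands; [below] recovers the bound. *)
Definition word := seq (nat * bool).

Definition below (k : nat) : pred word := all (fun g => g.1 < k)%N.

(** The closure properties shared by all the consequences of a Hecke algebra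
    relation: invariance under the braid relations in any context, and passage
    from a switched and a smoothed word to the original one. *)
Record skein_closed (G : word -> Prop) : Prop := SkeinClosed {
  skein_far : forall A B i j b c, (i.+1 < j)%N || (j.+1 < i)%N ->
    G (A ++ [:: (i, b); (j, c)] ++ B) -> G (A ++ [:: (j, c); (i, b)] ++ B);
  skein_cancel : forall A B i b,
    G (A ++ B) -> G (A ++ [:: (i, b); (i, ~~ b)] ++ B);
  skein_braid : forall A B i b1 b2 b3, (b1 == b2) || (b2 == b3) ->
    G (A ++ [:: (i, b1); (i.+1, b2); (i, b3)] ++ B) ->
    G (A ++ [:: (i.+1, b3); (i, b2); (i.+1, b1)] ++ B);
  skein_switch : forall A B i b,
    G (A ++ (i, ~~ b) :: B) -> G (A ++ B) -> G (A ++ (i, b) :: B)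
}.

Lemma skein_closed_context G A0 B0 :
  skein_closed G -> skein_closed (fun w => G (A0 ++ w ++ B0)).
Proof.
case=> far cancel braid switch; split=> A B i.
- by move=> j b c ij; have := far (A0 ++ A) (B ++ B0) i j b c ij; rewrite -!catA.
- by move=> b; have := cancel (A0 ++ A) (B ++ B0) i b; rewrite -!catA.
- move=> b1 b2 b3 b123.
  by have := braid (A0 ++ A) (B ++ B0) i b1 b2 b3 b123; rewrite -!catA.
- by move=> b; have := switch (A0 ++ A) (B ++ B0) i b; rewrite -!catA.
Qed.

Lemma below_cat k w w' : below k (w ++ w') = below k w && below k w'.
Proof. exact: all_cat. Qed.

Lemma below_leq k k' w : (k <= k')%N -> below k w -> below k' w.
Proof. by move=> le; apply: sub_all => g /leq_trans; apply. Qed.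

Lemma below_split k w : below k.+1 w -> below k w \/
  exists u b w', [/\ w = u ++ (k, b) :: w', below k u & below k.+1 w'].
Proof.
elim: w => [|[i b] w IH] /=; first by left.
rewrite ltnS; case/andP=> lei /[dup] bw /IH.
case: (ltngtP i k) lei => [ltik _|//|-> _]; last by right; exists [::], b, w.
case=> [->|[u [c [w' [-> bu bw']]]]]; first by left.
by right; exists ((i, b) :: u), c, w'; split=> //=; rewrite ltik.
Qed.

Section SkeinReduction.
Variables (G : word -> Prop) (GP : skein_closed G).

Lemma slide_left A B k e u : below k u ->
  G (A ++ u ++ (k.+1, e) :: B) -> G (A ++ (k.+1, e) :: u ++ B).
Proof.
elim: u A => [|[i b] u IH] A //= /andP[ltik bu] H.
apply: (@skein_far _ GP A (u ++ B) i k.+1 b e); first by rewrite ltnS ltik.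
by rewrite /= -cat_rcons; apply: IH => //; rewrite cat_rcons.
Qed.

Lemma slide_right A B k e u : below k u ->
  G (A ++ (k.+1, e) :: u ++ B) -> G (A ++ u ++ (k.+1, e) :: B).
Proof.
elim: u A => [|[i b] u IH] A //= /andP[ltik bu] H.
rewrite -cat_rcons; apply: IH => //; rewrite cat_rcons.
by apply: (@skein_far _ GP A (u ++ B) k.+1 i e b); rewrite // ltnS ltik orbT.
Qed.

(** sigma^2 = z sigma + 1, and sigma sigma^-1 = 1. *)
Lemma skein_square A B k e f :
  G (A ++ B) -> G (A ++ (k, e) :: B) -> G (A ++ [:: (k, e); (k, f)] ++ B).
Proof.
move=> G0 G1; have Gc := skein_cancel GP k e G0.
have [->|->] : f = e \/ f = ~~ e by case: (e) (f) => [] []; auto.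
  by rewrite /= -cat_rcons; apply: (skein_switch GP); rewrite cat_rcons.
exact: Gc.
Qed.

(** If the sign of the middle letter agrees with a neighbour, a braid relation
    leaves a single letter k + 1; otherwise both neighbours have the opposite
    sign, so that the middle letter can be switched to agree with them, and
    its smoothing gives a square. *)
Lemma skein_sandwich A B k e g f :
    G (A ++ B) -> G (A ++ (k.+1, e) :: B) ->
    (forall u, G (A ++ (k, f) :: (k.+1, u) :: (k, e) :: B)) ->
  G (A ++ [:: (k.+1, e); (k, g); (k.+1, f)] ++ B).
Proof.
move=> G0 G1 G3.
have ok u : (f == u) || (u == e) ->
    G (A ++ [:: (k.+1, e); (k, u); (k.+1, f)] ++ B).
  by move=> fu; apply: (skein_braid GP) => //; apply: G3.
case fg: ((f == g) || (g == e)); first exact: ok.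
rewrite /= -cat_rcons; apply: (skein_switch GP); rewrite cat_rcons.
  by apply: ok; case: (e) (f) (g) fg => [] [] [].
exact: skein_square.
Qed.

End SkeinReduction.

Definition occurrences (k : nat) (w : word) := count (fun g => g.1 == k) w.

Lemma occurrences_below k k' w :
  (k <= k')%N -> below k w -> occurrences k' w = 0%N.
Proof.
move=> le /allP bw; apply/eqP; rewrite -leqn0 leqNgt -has_count.
by apply/hasPn => g /bw; rewrite neq_ltn => /leq_trans ->.
Qed.

(** It is enough to treat two letters k separated by a word in smaller letters,
    by induction on the number of letters k. *)
Lemma skein_reduction_pair k (G : word -> Prop) :
    (forall u, below k u -> G u) ->
    (forall u b u', below k u -> below k u' -> G (u ++ (k, b) :: u')) ->
    (forall u e v f w, below k u -> below k v -> below k.+1 w ->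
      (forall w0, below k.+1 w0 ->
         (occurrences k w0 <= (occurrences k w).+1)%N -> G w0) ->
      G (u ++ (k, e) :: v ++ (k, f) :: w)) ->
  forall w, below k.+1 w -> G w.
Proof.
move=> G0 G1 Gstep w; have [N] := ubnP (occurrences k w).
elim: N w => // N IHN w ltwN.
case/below_split=> [|[u [e [w' [wE bu]]]]]; first exact: G0.
case/below_split=> [|[v [f [w'' [w'E bv bw'']]]]]; first by rewrite wE; apply: G1.
rewrite wE w'E; apply: Gstep => // w0 bw0 lew0; apply: IHN => //.
apply: leq_ltn_trans lew0 _; rewrite -ltnS (leq_trans _ ltwN) //.
rewrite wE w'E /occurrences count_cat /= count_cat /= !eqxx; lia.
Qed.

(** The spanning property H + H sigma_k H, where H is generated by the smaller
    letters.  Two letters k + 1 enclose a word which, by induction on k applied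
    to the predicate with the enclosing context, has at most one letter k;
    smaller letters commute with k + 1 and move outside, and what remains is a
    square or a sandwich. *)
Lemma skein_reduction k (G : word -> Prop) : skein_closed G ->
    (forall u, below k u -> G u) ->
    (forall u b u', below k u -> below k u' -> G (u ++ (k, b) :: u')) ->
  forall w, below k.+1 w -> G w.
Proof.
elim: k G => [|k IHk] G GP G0 G1; apply: skein_reduction_pair => // u e v f w bu bv bw IH.
  have -> : v = [::] by case: (v) bv.
  have bu1 := below_leq (leqnSn 0) bu.
  apply: (skein_square GP); apply: IH; rewrite ?below_cat ?bu1 //.
    by rewrite /occurrences count_cat -/(occurrences 0 u) (occurrences_below _ bu).
  by rewrite /occurrences count_cat -/(occurrences 0 u) (occurrences_below _ bu).
have bu1 := below_leq (leqnSn _) bu.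
have few v0 v1 : below k.+1 v0 -> below k.+2 v1 -> (occurrences k.+1 v1 <= 1)%N ->
    G (u ++ v0 ++ v1 ++ w).
  move=> bv0 bv1 le1; apply: IH; first by rewrite !below_cat bu1 (below_leq _ bv0) ?bv1.
  rewrite /occurrences !count_cat -!/(occurrences _ _).
  rewrite (occurrences_below _ bu) // (occurrences_below _ bv0) // !add0n.
  by rewrite -[leqRHS]add1n leq_add2r.
have GP' := skein_closed_context (rcons u (k.+1, e)) ((k.+1, f) :: w) GP.
suff : G (rcons u (k.+1, e) ++ v ++ (k.+1, f) :: w) by rewrite cat_rcons.
apply: (IHk _ GP') bv => [v0 bv0|v0 g v1 bv0 bv1]; rewrite cat_rcons.
  apply: (slide_left GP) => //; rewrite catA.
  have bv0' := below_leq (leqnSn _) bv0.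
  apply: (skein_square GP); rewrite -catA.
    by apply: (few v0 [::]).
  by apply: (few v0 [:: (k.+1, e)]); rewrite //= ?ltnSn ?eqxx.
rewrite -catA; apply: (slide_left GP) => //.
rewrite /=.
have -> : u ++ v0 ++ (k.+1, e) :: (k, g) :: v1 ++ (k.+1, f) :: w
  = ((u ++ v0) ++ [:: (k.+1, e); (k, g)]) ++ v1 ++ (k.+1, f) :: w by rewrite -!catA.
apply: (slide_right GP) => //; rewrite -!catA /= catA.
have bv0' := below_leq (leqnSn _) bv0.
have bv1' := below_leq (leqW (leqnSn _)) bv1.
have fewer v' : below k.+2 v' -> (occurrences k.+1 v' <= 1)%N ->
    G ((u ++ v0) ++ v' ++ v1 ++ w).
  move=> bv' le1; have := few v0 (v' ++ v1); rewrite -!catA; apply=> //.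
    by rewrite below_cat bv'.
  by rewrite /occurrences count_cat -!/(occurrences _ _) (occurrences_below _ bv1) ?addn0.
apply: (skein_sandwich GP).
- exact: (fewer [::]).
- by apply: (fewer [:: (k.+1, e)]); rewrite /= ?ltnSn ?eqxx.
- move=> t; apply: (fewer [:: (k, f); (k.+1, t); (k, e)]);
    rewrite /= ?ltnSn ?(ltnW (ltnSn k.+1)) //.
  by rewrite eqxx ltn_eqF.
Qed.

(** * Isotopies of closed braids *)

Section BraidClosures.
Local Open Scope nat_scope.

(** The strands entering and leaving a piece: unlike [slice_step], a form from
    which a run can be computed when the level is split at the piece. *)
Variant piece_strands : piece -> level -> level -> Prop :=
| CupStrands o : piece_strands (Cup o) [::] [:: o; ~~ o]
| CapStrands o : piece_strands Cap [:: o; ~~ o] [::]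
| CrossStrands b o1 o2 : piece_strands (Cross b) [:: o1; o2] [:: o2; o1].

Lemma run_piece k x y s l t D : piece_strands k x y -> s = l ++ x ++ t ->
  run s ((size l, k) :: D) = run (l ++ y ++ t) D.
Proof.
move=> kxy ->; rewrite /= drop_size_cat // take_size_cat //.
case: kxy => [o|o|b o1 o2] /=; first by rewrite size_cat leq_addr.
  by case: o.
by [].
Qed.

Definition cups n : diagram := [seq (i, Cup true) | i <- iota 0 n].
Definition caps n : diagram := rev [seq (i, Cap) | i <- iota 0 n].
Definition crossings (w : word) : diagram := [seq (g.1, Cross g.2) | g <- w].
Definition closure n (w : word) : diagram := cups n ++ crossings w ++ caps n.

Definition closure_level n : level := nseq n true ++ nseq n false.

Lemma cupsS n : cups n.+1 = cups n ++ [:: (n, Cup true)].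
Proof. by rewrite /cups -[in LHS]addn1 iotaD map_cat. Qed.

Lemma capsS n : caps n.+1 = (n, Cap) :: caps n.
Proof. by rewrite /caps -[in LHS]addn1 iotaD map_cat rev_cat. Qed.

Lemma nseqSr T k (x : T) : nseq k.+1 x = nseq k x ++ [:: x].
Proof. by rewrite -addn1 nseqD. Qed.

Lemma closure_levelS n :
  closure_level n.+1 = nseq n true ++ [:: true; false] ++ nseq n false.
Proof. by rewrite /closure_level nseqSr -catA. Qed.

Lemma run_cups n : run [::] (cups n) = Some (closure_level n).
Proof.
elim: n => // n IH; rewrite cupsS run_cat IH.
rewrite -[n in (n, _)](size_nseq n true).
rewrite [obind _ _](run_piece _ (CupStrands true) (erefl _)).
by rewrite closure_levelS.
Qed.

Lemma run_caps n : run (closure_level n) (caps n) = Some [::].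
Proof.
elim: n => // n IH; rewrite capsS -[n in (n, _)](size_nseq n true).
by rewrite (run_piece _ (CapStrands true) (closure_levelS n)).
Qed.

Lemma closure_level_left n i : i.+2 <= n ->
  closure_level n = nseq i true ++ [:: true; true]
                      ++ nseq (n - i.+2) true ++ nseq n false.
Proof.
move=> le; rewrite /closure_level -{1}(subnKC le) -addn2 -addnA !nseqD.
by rewrite -!catA.
Qed.

Lemma run_crossings n w : below n.-1 w ->
  run (closure_level n) (crossings w) = Some (closure_level n).
Proof.
elim: w => //= -[i b] w IH /andP[/= ltin /IH {}IH].
have le : i.+2 <= n by lia.
have := run_piece (crossings w) (CrossStrands b true true) (closure_level_left le).
by rewrite size_nseq -closure_level_left //= => ->.
Qed.

Lemma crossings_cat w w' : crossings (w ++ w') = crossings w ++ crossings w'.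
Proof. exact: map_cat. Qed.

Section Isotopy.
Variables (P : diagram -> Lvz) (HP : is_homflypt P).

(** Recording the levels at both ends makes this relation a congruence for
    concatenation, and restricts the comparison of P to link diagrams. *)
Definition interchangeable s t D D' :=
  [/\ run s D = Some t, run s D' = Some t
    & forall A B, run [::] A = Some s -> run t B = Some [::] ->
        P (A ++ D ++ B) = P (A ++ D' ++ B)].

Lemma interchangeable_sym s t D D' :
  interchangeable s t D D' -> interchangeable s t D' D.
Proof. by case=> rD rD' e; split=> // A B rA rB; rewrite e. Qed.

Lemma interchangeable_trans s t D2 D1 D3 : interchangeable s t D1 D2 ->
  interchangeable s t D2 D3 -> interchangeable s t D1 D3.
Proof.
by case=> r1 r2 e12 [_ r3 e23]; split=> // A B rA rB; rewrite e12 // e23.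
Qed.

Lemma interchangeable_refl s t D : run s D = Some t -> interchangeable s t D D.
Proof. by move=> rD; split. Qed.

Lemma interchangeable_catl s t r A D D' : run r A = Some s ->
  interchangeable s t D D' -> interchangeable r t (A ++ D) (A ++ D').
Proof.
move=> rA [rD rD' e]; split=> [||A' B rA' rB]; [by rewrite run_cat rA..|].
by rewrite -!catA !(catA A') e // run_cat rA'.
Qed.

Lemma interchangeable_catr s t r B D D' : run t B = Some r ->
  interchangeable s t D D' -> interchangeable s r (D ++ B) (D' ++ B).
Proof.
move=> rB [rD rD' e]; split=> [||A B' rA rB'].
- by rewrite run_cat rD.
- by rewrite run_cat rD'.
by rewrite -!catA e // run_cat rB.
Qed.

Lemma interchangeable_P D D' : interchangeable [::] [::] D D' -> P D = P D'.
Proof. by case=> _ _ /(_ [::] [::] erefl erefl); rewrite /= !cats0. Qed.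

Lemma interchangeable_move s t D D' : local_move D D' ->
  run s D = Some t -> run s D' = Some t -> interchangeable s t D D'.
Proof.
move=> mv rD rD'; split=> // A B rA rB.
by apply: (homflypt_invariant HP) => //;
  rewrite /is_link_diagram run_cat rA /= run_cat ?rD ?rD'.
Qed.

Lemma size_strands k x y : piece_strands k x y ->
  size x = strands_in k /\ size y = strands_out k.
Proof. by case. Qed.

Lemma interchangeable_exchange a m r k l x x' y y' i j j' :
    piece_strands k x x' -> piece_strands l y y' ->
    i = size a -> j = i + strands_out k + size m ->
    j' = i + strands_in k + size m ->
  interchangeable (a ++ x ++ m ++ y ++ r) (a ++ x' ++ m ++ y' ++ r)
    [:: (i, k); (j, l)] [:: (j', l); (i, k)].
Proof.
move=> kx ly -> -> ->; have [sx sx'] := size_strands kx.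
apply: interchangeable_move; first exact: move_exchange.
  rewrite (run_piece _ kx (erefl _)) -sx' -addnA -!size_cat.
  by rewrite (run_piece _ ly (t := r)) -?catA.
rewrite -sx -addnA -!size_cat (run_piece _ ly (t := r)) -?catA //.
by rewrite (run_piece _ kx (erefl _)).
Qed.

Lemma interchangeable_cap l t o y b i : i = size l ->
  interchangeable (l ++ [:: o; y; ~~ o] ++ t) (l ++ y :: t)
    [:: (i.+1, Cross b); (i, Cap)] [:: (i, Cross (~~ b)); (i.+1, Cap)].
Proof.
move=> ->; have szr x : (size l).+1 = size (rcons l x) by rewrite size_rcons.
apply: interchangeable_move; first exact: move_cap.
  rewrite (szr o) (run_piece _ (CrossStrands b y (~~ o)) (t := t)) ?cat_rcons //.
  by rewrite (run_piece _ (CapStrands o) (t := y :: t)).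
rewrite (run_piece _ (CrossStrands (~~ b) o y) (t := ~~ o :: t)) //.
by rewrite (szr y) (run_piece _ (CapStrands o) (t := t)) ?cat_rcons.
Qed.

Lemma interchangeable_cup l t o y b i : i = size l ->
  interchangeable (l ++ y :: t) (l ++ [:: o; y; ~~ o] ++ t)
    [:: (i, Cup o); (i.+1, Cross b)] [:: (i.+1, Cup o); (i, Cross (~~ b))].
Proof.
move=> ->; have szr x : (size l).+1 = size (rcons l x) by rewrite size_rcons.
apply: interchangeable_move; first exact: move_cup.
  rewrite (run_piece _ (CupStrands o) (t := y :: t)) //.
  by rewrite (szr o) (run_piece _ (CrossStrands b (~~ o) y) (t := t)) ?cat_rcons.
rewrite (szr y) (run_piece _ (CupStrands o) (t := t)) ?cat_rcons //.
by rewrite (run_piece _ (CrossStrands (~~ b) y o) (t := ~~ o :: t)).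
Qed.

(** A crossing passes through two nested caps: turn it around the outer left leg
    at the inner cap, exchange the two caps, now side by side, and turn it once
    more at the other one. *)
Lemma nested_caps l t o b i : i = size l ->
  interchangeable (l ++ [:: o; o; ~~ o; ~~ o] ++ t) (l ++ t)
    [:: (i, Cross b); (i.+1, Cap); (i, Cap)]
    [:: (i.+2, Cross b); (i.+1, Cap); (i, Cap)].
Proof.
move=> il; have il' : i.+1 = size (rcons l o) by rewrite size_rcons il.
have last_cap : run (l ++ o :: ~~ o :: t) [:: (i, Cap)] = Some (l ++ t).
  by rewrite il (run_piece _ (CapStrands o) (t := t)).
apply: (@interchangeable_trans _ _ [:: (i.+1, Cross (~~ b)); (i, Cap); (i, Cap)]).
  apply: (@interchangeable_catr _ _ _ [:: (i, Cap)] [:: _; _] [:: _; _] last_cap).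
  apply: interchangeable_sym; rewrite -[b in X in interchangeable _ _ _ X]negbK.
  exact: (interchangeable_cap (~~ o :: t) o o (~~ b) il).
apply: (@interchangeable_trans _ _ [:: (i.+1, Cross (~~ b)); (i.+2, Cap); (i, Cap)]).
  apply: (@interchangeable_catl (l ++ [:: o; ~~ o; o; ~~ o] ++ t)
            _ _ [:: _] [:: _; _] [:: _; _]).
    rewrite il' (run_piece _ (CrossStrands _ o (~~ o)) (t := ~~ o :: t)) ?cat_rcons //.
  by apply: (@interchangeable_exchange l [::] t _ _ _ _ _ _ _ _ _
               (CapStrands o) (CapStrands o)) => //=; lia.
apply: (@interchangeable_catr _ _ _ [:: (i, Cap)] [:: _; _] [:: _; _] last_cap).
apply: interchangeable_sym.
by have := interchangeable_cap t o (~~ o) b il'; rewrite !cat_rcons.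
Qed.

Lemma nested_cups l t o b i : i = size l ->
  interchangeable (l ++ t) (l ++ [:: o; o; ~~ o; ~~ o] ++ t)
    [:: (i, Cup o); (i.+1, Cup o); (i.+2, Cross b)]
    [:: (i, Cup o); (i.+1, Cup o); (i, Cross b)].
Proof.
move=> il; have il' : i.+1 = size (rcons l o) by rewrite size_rcons il.
have first_cup : run (l ++ t) [:: (i, Cup o)] = Some (l ++ o :: ~~ o :: t).
  by rewrite il (run_piece _ (CupStrands o) (t := t)).
apply: (@interchangeable_trans _ _ [:: (i, Cup o); (i.+2, Cup o); (i.+1, Cross (~~ b))]).
  apply: (@interchangeable_catl _ _ _ [:: (i, Cup o)] [:: _; _] [:: _; _] first_cup).
  by have := interchangeable_cup t o (~~ o) b il'; rewrite !cat_rcons.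
apply: (@interchangeable_trans _ _ [:: (i, Cup o); (i, Cup o); (i.+1, Cross (~~ b))]).
  apply: (@interchangeable_catr _ (l ++ [:: o; ~~ o; o; ~~ o] ++ t)
            _ [:: _] [:: _; _] [:: _; _]).
    by rewrite il' (run_piece _ (CrossStrands _ (~~ o) o) (t := ~~ o :: t)) ?cat_rcons.
  by apply: (@interchangeable_exchange l [::] t _ _ _ _ _ _ _ _ _
               (CupStrands o) (CupStrands o)) => //=; lia.
apply: (@interchangeable_catl _ _ _ [:: (i, Cup o)] [:: _; _] [:: _; _] first_cup).
rewrite -[b in X in interchangeable _ _ _ X]negbK.
exact: (interchangeable_cup (~~ o :: t) o o (~~ b) il).
Qed.

Lemma closure_level_right n j : j.+2 <= n ->
  closure_level n = nseq n true ++ nseq j false ++ [:: false; false]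
                      ++ nseq (n - j.+2) false.
Proof.
move=> le; congr (_ ++ _); rewrite -[[:: _; _]]/(nseq 2 false) -!nseqD.
by congr nseq; lia.
Qed.

Lemma closure_level_cap n :
  run (closure_level n.+1) [:: (n, Cap)] = Some (closure_level n).
Proof.
rewrite -[n in (n, _)](size_nseq n true).
by rewrite (run_piece _ (CapStrands true) (closure_levelS n)).
Qed.

Lemma closure_level_cup n :
  run (closure_level n) [:: (n, Cup true)] = Some (closure_level n.+1).
Proof.
rewrite -[n in (n, _)](size_nseq n true).
by rewrite (run_piece _ (CupStrands true) (erefl _)) closure_levelS.
Qed.

Lemma closure_levelS_left n i : i.+2 <= n ->
  closure_level n.+1 = nseq i true ++ [:: true; true]
    ++ nseq (n - i.+2) true ++ [:: true; false] ++ nseq n false.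
Proof.
move=> le; rewrite closure_levelS -[[:: true; true]]/(nseq 2 true) !catA -!nseqD.
by congr ((nseq _ _ ++ _) ++ _); lia.
Qed.

Lemma closure_levelS_right n j : j.+2 <= n ->
  closure_level n.+1 = nseq n true ++ [:: true; false]
    ++ nseq j false ++ [:: false; false] ++ nseq (n - j.+2) false.
Proof.
move=> le; rewrite closure_levelS; congr (_ ++ _ ++ _).
by rewrite -[[:: false; false]]/(nseq 2 false) -!nseqD; congr nseq; lia.
Qed.

Lemma exchange_left_cap n i b : i.+2 <= n ->
  interchangeable (closure_level n.+1) (closure_level n)
    [:: (i, Cross b); (n, Cap)] [:: (n, Cap); (i, Cross b)].
Proof.
move=> le; rewrite (closure_levelS_left le) (closure_level_left le).
by apply: (@interchangeable_exchange _ _ _ _ _ _ _ _ [::] _ _ _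
  (CrossStrands b true true) (CapStrands true)); rewrite !size_nseq //=; lia.
Qed.

Lemma exchange_left_cup n i b : i.+2 <= n ->
  interchangeable (closure_level n) (closure_level n.+1)
    [:: (i, Cross b); (n, Cup true)] [:: (n, Cup true); (i, Cross b)].
Proof.
move=> le; rewrite (closure_levelS_left le) (closure_level_left le).
by apply: (@interchangeable_exchange _ _ _ _ _ _ _ [::] _ _ _ _
  (CrossStrands b true true) (CupStrands true)); rewrite !size_nseq //=; lia.
Qed.

Lemma exchange_right_cap n j b : j.+2 <= n ->
  interchangeable (closure_level n.+1) (closure_level n)
    [:: (n, Cap); (n + j, Cross b)] [:: (n + j.+2, Cross b); (n, Cap)].
Proof.
move=> le; rewrite (closure_levelS_right le) (closure_level_right le).
by apply: (@interchangeable_exchange _ _ _ _ _ _ [::] _ _ _ _ _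
  (CapStrands true) (CrossStrands b false false)); rewrite !size_nseq //=; lia.
Qed.

Lemma exchange_right_cup n j b : j.+2 <= n ->
  interchangeable (closure_level n) (closure_level n.+1)
    [:: (n, Cup true); (n + j.+2, Cross b)] [:: (n + j, Cross b); (n, Cup true)].
Proof.
move=> le; rewrite (closure_levelS_right le) (closure_level_right le).
by apply: (@interchangeable_exchange _ _ _ _ _ [::] _ _ _ _ _ _
  (CupStrands true) (CrossStrands b false false)); rewrite !size_nseq //=; lia.
Qed.

(** The caps nested inside those of strands i and i + 1 are exchanged with the
    crossing on their left, and exchanged back once [nested_caps] has brought
    the crossing to their right, where its mirror position is i + 2 d + 2. *)
Lemma caps_slide i d b :
  interchangeable (closure_level (i + d.+2)) [::]
    ((i, Cross b) :: caps (i + d.+2))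
    ((i + d.*2.+2, Cross b) :: caps (i + d.+2)).
Proof.
elim: d => [|d IH].
  have -> : i + 0.*2.+2 = i.+2 by lia.
  have E := nested_caps (nseq i false) true b (esym (size_nseq i true)).
  rewrite !capsS.
  apply: (@interchangeable_catr _ _ _ _ [:: _; _; _] [:: _; _; _] (run_caps i)).
  move: E; rewrite /closure_level -[i.+2]addn2 nseqD [i + 2]addnC nseqD.
  by rewrite -catA.
rewrite addnS capsS; set n := i + d.+2 in IH *.
have [lei led] : i.+2 <= n /\ d.+2 <= n by rewrite /n; lia.
apply: (@interchangeable_trans _ _ [:: (n, Cap), (i, Cross b) & caps n]).
  apply: (@interchangeable_catr _ _ _ _ [:: _; _] [:: _; _] (run_caps n)).
  exact: exchange_left_cap.
apply: (@interchangeable_trans _ _ [:: (n, Cap), (i + d.*2.+2, Cross b) & caps n]).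
  exact: (interchangeable_catl (closure_level_cap n) IH).
apply: (@interchangeable_catr _ _ _ _ [:: _; _] [:: _; _] (run_caps n)).
have -> : i + d.*2.+2 = n + d by rewrite /n; lia.
have -> : i + d.+1.*2.+2 = n + d.+2 by rewrite /n; lia.
exact: exchange_right_cap.
Qed.

Lemma cups_slide i d b :
  interchangeable [::] (closure_level (i + d.+2))
    (cups (i + d.+2) ++ [:: (i + d.*2.+2, Cross b)])
    (cups (i + d.+2) ++ [:: (i, Cross b)]).
Proof.
elim: d => [|d IH].
  have -> : i + 0.*2.+2 = i.+2 by lia.
  have E := nested_cups (nseq i false) true b (esym (size_nseq i true)).
  rewrite !cupsS -!catA; apply: interchangeable_catl (run_cups i) _.
  move: E; rewrite /closure_level -[i.+2]addn2 nseqD [i + 2]addnC nseqD.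
  by rewrite -catA.
rewrite addnS cupsS; set n := i + d.+2 in IH *; rewrite -!catA.
have [lei led] : i.+2 <= n /\ d.+2 <= n by rewrite /n; lia.
pose D j := cups n ++ [:: (j, Cross b); (n, Cup true)].
apply: (@interchangeable_trans _ _ (D (i + d.*2.+2))).
  apply: interchangeable_catl (run_cups n) _.
  have -> : i + d.*2.+2 = n + d by rewrite /n; lia.
  have -> : i + d.+1.*2.+2 = n + d.+2 by rewrite /n; lia.
  exact: exchange_right_cup.
apply: (@interchangeable_trans _ _ (D i)).
  by have := interchangeable_catr (closure_level_cup n) IH; rewrite -!catA.
apply: interchangeable_catl (run_cups n) _.
exact: exchange_left_cup.
Qed.

Lemma crossings_slide_cross n w j b : below n.-1 w -> n <= j -> j.+2 <= n.*2 ->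
  interchangeable (closure_level n) (closure_level n)
    (crossings w ++ [:: (j, Cross b)]) ((j, Cross b) :: crossings w).
Proof.
move=> bw lenj ltj.
have run_j : run (closure_level n) [:: (j, Cross b)] = Some (closure_level n).
  have le : (j - n).+2 <= n by lia.
  have E := closure_level_right le; rewrite catA in E.
  have := run_piece [::] (CrossStrands b false false) E.
  by rewrite -E size_cat !size_nseq subnKC.
elim: w bw => [_|[i c] w IH /= /andP[/= lti bw]].
  exact: interchangeable_refl.
apply: (@interchangeable_trans _ _ [:: (i, Cross c), (j, Cross b) & crossings w]).
  apply: (@interchangeable_catl _ _ _ [:: _] (_ ++ _) (_ :: _) _ (IH bw)).
  by apply: (@run_crossings _ [:: (i, c)]); rewrite /= lti.
apply: (@interchangeable_catr _ _ _ _ [:: _; _] [:: _; _] (run_crossings bw)).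
have -> : closure_level n = nseq i true ++ [:: true; true]
    ++ (nseq (n - i.+2) true ++ nseq (j - n) false) ++ [:: false; false]
    ++ nseq (n.*2 - j.+2) false.
  rewrite /closure_level -[[:: true; _]]/(nseq 2 true) -[[:: false; _]]/(nseq 2 false).
  rewrite -!catA -!nseqD !catA -!nseqD; congr (nseq _ _ ++ nseq _ _); lia.
by apply: (interchangeable_exchange _ (CrossStrands c true true)
  (CrossStrands b false false)); rewrite ?size_cat !size_nseq //=; lia.
Qed.

Lemma crossings_slide_cup n w : below n.-1 w ->
  interchangeable (closure_level n) (closure_level n.+1)
    ((n, Cup true) :: crossings w) (crossings w ++ [:: (n, Cup true)]).
Proof.
elim: w => [_|[i c] w IH /= /andP[/= lti bw]].
  exact: interchangeable_refl (closure_level_cup n).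
apply: (@interchangeable_trans _ _ [:: (i, Cross c), (n, Cup true) & crossings w]);
  last first.
  apply: (@interchangeable_catl _ _ _ [:: _] (_ :: _) (_ ++ _) _ (IH bw)).
  by apply: (@run_crossings _ [:: (i, c)]); rewrite /= lti.
apply: (@interchangeable_catr _ (closure_level n.+1) _ _ [:: _; _] [:: _; _]).
  by apply: run_crossings; apply: sub_all bw => g; lia.
by apply/interchangeable_sym/exchange_left_cup; lia.
Qed.

(** The crossing travels once around the closure. *)
Lemma conjugation n w i b : below n.-1 w -> i < n.-1 ->
  P (closure n (rcons w (i, b))) = P (closure n ((i, b) :: w)).
Proof.
move=> bw lti; pose d := n - i.+2.
have nE : n = i + d.+2 by rewrite /d; lia.
have caps_i := caps_slide i d b; have cups_i := cups_slide i d b.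
rewrite -nE in caps_i cups_i; apply: interchangeable_P.
set j := i + d.*2.+2 in caps_i cups_i.
rewrite /closure -cats1 crossings_cat -catA.
apply: (@interchangeable_trans _ _ (cups n ++ crossings w ++ (j, Cross b) :: caps n)).
  apply: interchangeable_catl (run_cups n) _.
  exact: interchangeable_catl (run_crossings bw) caps_i.
apply: (@interchangeable_trans _ _ (cups n ++ (j, Cross b) :: crossings w ++ caps n)).
  apply: interchangeable_catl (run_cups n) _.
  have lenj : n <= j by lia.
  have ltj : j.+2 <= n.*2 by lia.
  have := interchangeable_catr (run_caps n) (crossings_slide_cross b bw lenj ltj).
  by rewrite -!catA.
have rest : run (closure_level n) (crossings w ++ caps n) = Some [::].
  by rewrite run_cat (run_crossings bw) /= run_caps.
by have := interchangeable_catr rest cups_i; rewrite -!catA.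
Qed.

(** The innermost cup slides up past the braid, and the last crossing becomes a
    kink. *)
Lemma stabilization n w b : below n.-1 w -> 0 < n ->
  P (closure n.+1 (rcons w (n.-1, b))) = P (closure n w).
Proof.
move=> bw n0; apply: interchangeable_P.
rewrite /closure -cats1 crossings_cat cupsS capsS -!catA.
apply: interchangeable_catl (run_cups n) _.
apply: (@interchangeable_trans _ _ ((crossings w ++ [:: (n, Cup true)])
          ++ (n.-1, Cross b) :: (n, Cap) :: caps n)).
  apply: (@interchangeable_catr _ _ _ _ (_ :: _) (_ ++ _) _ (crossings_slide_cup bw)).
  rewrite -[X in run _ X]/(crossings [:: (n.-1, b)] ++ (n, Cap) :: caps n) -capsS.
  rewrite run_cat run_crossings ?[obind _ _]run_caps //=.
  by rewrite prednK // leqnn.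
rewrite -catA; apply: interchangeable_catl (run_crossings bw) _.
apply: (@interchangeable_catr _ _ _ _ [:: _; _; _] [::] (run_caps n)).
have R1 : local_move [:: (n, Cup true); (n.-1, Cross b); (n, Cap)] [::].
  by have := move_R1r n.-1 true b; rewrite prednK.
apply: interchangeable_move => //.
rewrite (run_cat _ [:: _]) closure_level_cup.
rewrite -[LHS]/(run (closure_level n.+1) (crossings [:: (n.-1, b)] ++ [:: (n, Cap)])).
by rewrite run_cat run_crossings ?[obind _ _]closure_level_cap //= prednK // leqnn.
Qed.

End Isotopy.

End BraidClosures.

(** * Skein triples *)

Definition word_writhe (w : word) : int := \sum_(g <- w) (if g.2 then 1 else -1).

Lemma word_writhe_cat w w' : word_writhe (w ++ w') = word_writhe w + word_writhe w'.
Proof. exact: big_cat. Qed.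

Lemma word_writhe_cons g w :
  word_writhe (g :: w) = (if g.2 then 1 else -1) + word_writhe w.
Proof. exact: big_cons. Qed.

(** The coefficient ring is abstract here: z, its inverse and the sequence C are
    only used through the recursion. *)
Section Specialization.
Variables (R : comNzRingType) (z zV : R) (zK : zV * z = 1).
Variables (C : int -> R) (C0 : C 0 = 0) (C1 : C 1 = 1).
Hypothesis C_rec : forall k, C (k + 1) = z * C k + C (k - 1).

Lemma zmulK a : zV * (z * a) = a.
Proof. by rewrite mulrA zK mul1r. Qed.

(** The Morton-Franks-Williams support condition for n strands and writhe e, and
    the specialization at v = 1/u: as u^k = C_k u + C_(k-1), the equations below
    are the u-coordinates of u^k f(1/u) = u^k. *)
Definition admissible n (e : int) (f : laurent R) :=
  (forall l, (forall j, (j < n)%N -> l != e - n%:Z + 1 + 2 * j%:Z) -> f@_l = 0)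
  /\ forall k, pairing (fun l => C (k - l)) f = C k.

Section SkeinTriple.
Variables (n : nat) (e : int) (fpos f0 fneg : laurent R).
Hypothesis skein :
  fpos = laurent_monomial z 1 * f0 + laurent_monomial 1 2 * fneg.

Lemma skein_coef l : fpos@_l = z * f0@_(l - 1) + fneg@_(l - 2).
Proof. by rewrite skein mcoeffD !mcoeff_monoM mul1r. Qed.

Lemma skein_pairing k : pairing (fun l => C (k - l)) fpos
  = z * pairing (fun l => C (k - 1 - l)) f0 + pairing (fun l => C (k - 2 - l)) fneg.
Proof.
rewrite skein pairingD !pairing_monoM mul1r.
by congr (_ * _ + _); apply: eq_pairing => l; congr C; lia.
Qed.

Lemma admissible_pos : admissible n e f0 -> admissible n (e - 1) fneg ->
  admissible n (e + 1) fpos.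
Proof.
case=> s0 d0 [sn dn]; split=> [l ne|k].
  by rewrite skein_coef s0 ?sn ?mulr0 ?addr0 // => j /ne; lia.
rewrite skein_pairing d0 dn.
have := C_rec (k - 1); have -> : k - 1 + 1 = k by lia.
by have -> : k - 1 - 1 = k - 2 by lia.
Qed.

Lemma admissible_neg : admissible n (e + 1) fpos -> admissible n e f0 ->
  admissible n (e - 1) fneg.
Proof.
case=> sp dp [s0 d0]; split=> [l ne|k].
  have := skein_coef (l + 2); have -> : l + 2 - 2 = l by lia.
  by rewrite sp ?s0 ?mulr0 ?add0r // => j /ne; lia.
have := skein_pairing (k + 2); rewrite dp d0; have -> : k + 2 - 2 = k by lia.
have := C_rec (k + 1); have -> : k + 1 + 1 = k + 2 by lia.
have -> : k + 1 - 1 = k by lia.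
have -> : k + 2 - 1 = k + 1 by lia.
by move=> -> /addrI ->.
Qed.

(** This is where z has to be invertible, hence where the h_j become Laurent
    polynomials. *)
Lemma admissible_smoothing : admissible n (e + 1) fpos ->
  admissible n (e - 1) fneg -> admissible n e f0.
Proof.
case=> sp dp [sn dn]; split=> [l ne|k]; apply: (can_inj zmulK).
  have := skein_coef (l + 1); have -> : l + 1 - 1 = l by lia.
  by rewrite sp ?sn ?mulr0 ?addr0 // => j /ne; lia.
have := skein_pairing (k + 1); rewrite dp dn; have -> : k + 1 - 1 = k by lia.
have -> : k + 1 - 2 = k - 1 by lia.
by rewrite C_rec => /addIr ->.
Qed.

End SkeinTriple.

(** The degree window of length n on n strands is contained in that of length
    n + 1 on n + 1 strands: it has the same lower end after a positive
    stabilization, and the same upper end after a negative one. *)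
Lemma admissible_stabilization n e f b : admissible n e f ->
  admissible n.+1 (e + (if b then 1 else -1)) f.
Proof.
case=> s d; split=> // l ne; apply: s => j ltj.
case: b ne => ne; first by have := ne j (ltnW ltj); lia.
by have := ne j.+1 ltj; lia.
Qed.

Lemma admissible1 : admissible 1 0 1.
Proof.
split=> [l /(_ 0%N erefl) l0|k]; last first.
  by rewrite pairing_mono mul1r subr0.
by rewrite [LHS]mcoeff_monoE; case: eqP => // El; rewrite -El in l0; lia.
Qed.

Lemma C_opp_odd q : C (- (2 * q%:Z + 1)) = C (2 * q%:Z + 1).
Proof.
suff [] : C (- (2 * q%:Z + 1)) = C (2 * q%:Z + 1)
  /\ C (- (2 * q%:Z)) = - C (2 * q%:Z) by [].
elim: q => [|q [IH1 IH0]].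
  by have := C_rec 0; rewrite mulr0 !add0r oppr0 C0 oppr0 mulr0 add0r.
set t := 2 * q%:Z in IH1 IH0 *; have -> : 2 * q.+1%:Z = t + 2 by lia.
have e2 : C (- (t + 2)) = - C (t + 2).
  have := C_rec (- (t + 1)); have -> : - (t + 1) + 1 = - t by lia.
  have -> : - (t + 1) - 1 = - (t + 2) by lia.
  have := C_rec (t + 1); have -> : t + 1 + 1 = t + 2 by lia.
  have -> : t + 1 - 1 = t by lia.
  by rewrite IH1 IH0 => -> e; rewrite [RHS]opprD e addKr.
split=> //; have := C_rec (- (t + 2)); have -> : - (t + 2) + 1 = - (t + 1) by lia.
have -> : - (t + 2) - 1 = - (t + 2 + 1) by lia.
have := C_rec (t + 2); have -> : t + 2 - 1 = t + 1 by lia.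
by rewrite IH1 e2 mulrN => -> ->; ring.
Qed.

Lemma C2 : C 2 = z.
Proof. by have := C_rec 1; rewrite subrr C0 C1 mulr1 addr0. Qed.

Lemma C3 : C 3 = z * z + 1.
Proof. by have := C_rec 2; rewrite C2 C1. Qed.

Lemma CN1 : C (-1) = 1.
Proof. by have := C_opp_odd 0; rewrite mulr0 add0r C1. Qed.

Lemma CN2 : C (-2) = - z.
Proof.
have := C_rec (-1); rewrite addNr C0 CN1 mulr1 addrC => e.
by apply/eqP; rewrite -addr_eq0 -e.
Qed.

Lemma CN3 : C (-3) = z * z + 1.
Proof. by have := C_opp_odd 1; rewrite mulr1 C3. Qed.

(** * The Laurent MFW polynomials of an admissible polynomial *)

Section MfwPolynomials.
Variables (f : laurent R) (n : nat) (e : int) (m M : nat) (x : int).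
Hypothesis f_adm : admissible n e f.
Definition mfw_coef j : R := if (j < n)%N then f@_(e - n%:Z + 1 + 2 * j%:Z) else 0.
Local Notation h := mfw_coef.
Hypotheses (hm : h m != 0) (min_m : forall j, h j != 0 -> (m <= j)%N).
Hypotheses (hM : h M != 0) (max_M : forall j, h j != 0 -> (j <= M)%N).
Hypothesis f_mindeg : is_mindeg f x.

Lemma mfw_lt j : h j != 0 -> (j < n)%N.
Proof. by rewrite /h; case: ifP => // _; rewrite eqxx. Qed.

Lemma mfw_gt_max j : (M < j)%N -> h j = 0.
Proof. by move=> lt; apply/eqP; apply: contraTT lt => /max_M; rewrite leqNgt. Qed.

Lemma mfw_lt_min j : (j < m)%N -> h j = 0.
Proof. by move=> lt; apply/eqP; apply: contraTT lt => /min_m; rewrite leqNgt. Qed.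

Lemma mfw_mindeg : x = e - n%:Z + 1 + 2 * m%:Z.
Proof.
have [xf x_le] := f_mindeg; have ltm := mfw_lt hm; apply/eqP; rewrite eq_le.
apply/andP; split.
  by apply: x_le; rewrite -mcoeff_neq0; move: hm; rewrite /h ltm.
have [/existsP[j /eqP xE]|nex] := boolP [exists j : 'I_n, x == e - n%:Z + 1 + 2 * j%:Z].
  rewrite xE; suff : (m <= j)%N by lia.
  by apply: min_m; rewrite /h ltn_ord -xE mcoeff_neq0.
move: xf; rewrite -mcoeff_neq0 (proj1 f_adm) ?eqxx // => j ltj.
by apply: contra nex => xE; apply/existsP; exists (Ordinal ltj).
Qed.

Lemma mfw_expansion_all :
  f = \sum_(0 <= j < n) laurent_monomial (h j) (e - n%:Z + 1 + 2 * j%:Z).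
Proof.
rewrite big_mkord; apply/malgP => l; rewrite raddf_sum /=.
have [/existsP[j /eqP lE]|nex] := boolP [exists j : 'I_n, l == e - n%:Z + 1 + 2 * j%:Z].
  rewrite (bigD1 j) //= mcoeff_monoE -lE eqxx /h ltn_ord -lE big1 ?addr0 // => i.
  rewrite mcoeff_monoE lE => /eqP ne; case: eqP => // E.
  by case: ne; apply: ord_inj; lia.
rewrite (proj1 f_adm) => [|j ltj]; last first.
  by apply: contra nex => lE; apply/existsP; exists (Ordinal ltj).
rewrite big1 // => i _; rewrite mcoeff_monoE; case: eqP => // E.
by case/existsP: nex; exists i; rewrite E.
Qed.

Lemma sum_nat_extend (V : nmodType) (F : nat -> V) p q :
    (p <= q)%N -> (forall j, (p <= j)%N -> F j = 0) ->
  \sum_(0 <= j < q) F j = \sum_(0 <= j < p) F j.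
Proof.
move=> le F0; rewrite (big_cat_nat (leq0n p) le) //= [X in _ + X]big1_seq ?addr0 // => j.
by rewrite mem_index_iota => /andP[_ /andP[/F0]].
Qed.

(** The first three terms are always written out, even if M < m + 2, as the
    remaining sum is then empty and the terms beyond M vanish.  This lets one
    proof of the formulas cover all values of M - m. *)
Lemma mfw_expansion : f =
  laurent_monomial (h m) x + laurent_monomial (h m.+1) (x + 2)
  + laurent_monomial (h m.+2) (x + 4)
  + \sum_(3 <= j < (M - m).+1) laurent_monomial (h (m + j)%N) (x + 2 * j%:Z).
Proof.
have leM := max_M hm; have ltM := mfw_lt hM.
rewrite {1}mfw_expansion_all.
pose F j := laurent_monomial (h j) (e - n%:Z + 1 + 2 * j%:Z).
have F0 j : h j = 0 -> F j = 0 by rewrite /F => ->; rewrite mono0.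
have FM j : (M.+1 <= j)%N -> F j = 0 by move=> lt; apply/F0/mfw_gt_max.
rewrite -/(\sum_(0 <= j < n) F j) (sum_nat_extend ltM FM).
pose K := maxn 3 (M - m).+1.
rewrite -(@sum_nat_extend _ F M.+1 (m + K)) //; last by rewrite /K; lia.
rewrite (big_cat_nat (leq0n m) (leq_addr K m)) //=.
rewrite [X in X + _]big1_seq ?add0r; last first.
  by move=> j; rewrite mem_index_iota => /andP[_ /andP[_ /mfw_lt_min/F0]].
have FE j : F (m + j)%N = laurent_monomial (h (m + j)%N) (x + 2 * j%:Z).
  by rewrite /F mfw_mindeg; congr laurent_monomial; lia.
rewrite -{1}[m]add0n big_addn addKn.
under eq_bigr => j _ do rewrite addnC FE.
rewrite (big_cat_nat (leq0n 3) (leq_maxl 3 (M - m).+1)) //=.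
rewrite big_nat_recr //= big_nat_recr //= big_nat1.
rewrite addn0 addn1 addn2 mulr0 addr0; congr (_ + _); rewrite /K.
by case: (leqP 3 (M - m).+1) => lt; rewrite ?(maxn_idPr lt) // !big_geq // ltnW.
Qed.

Lemma pairing_mfw c : pairing c f = h m * c x + h m.+1 * c (x + 2) + h m.+2 * c (x + 4)
  + \sum_(3 <= j < (M - m).+1) h (m + j)%N * c (x + 2 * j%:Z).
Proof.
rewrite {1}mfw_expansion !pairingD !pairing_mono; congr (_ + _).
rewrite (big_morph _ (pairingD c) (pairing0 c)).
by apply: eq_bigr => j _; rewrite pairing_mono.
Qed.

Let nabla := laurent_at1 f.

Lemma nabla_mfw : nabla = h m + h m.+1 + h m.+2
  + \sum_(3 <= j < (M - m).+1) h (m + j)%N.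
Proof.
rewrite /nabla laurent_at1_pairing pairing_mfw !mulr1; congr (_ + _).
by apply: eq_bigr => j _; rewrite mulr1.
Qed.

(** Subtracting the value at v = 1 from the equation for k = x + 3 eliminates
    h_(m+1) and h_(m+2), whose coefficients are C_1 = C_(-1) = 1. *)
Lemma mfw_formula_min : h m = zV * zV * (C (x + 3) - nabla
  - \sum_(3 <= j < (M - m).+1) (C (2 * j%:Z - 3) - 1) * h (m + j)%N).
Proof.
have := proj2 f_adm (x + 3); rewrite pairing_mfw.
have -> : x + 3 - x = 3 by lia.
have -> : x + 3 - (x + 2) = 1 by lia.
have -> : x + 3 - (x + 4) = -1 by lia.
rewrite C3 C1 CN1 => <-; rewrite nabla_mfw.
under [X in _ - X]eq_bigr => j _ do rewrite mulrBl mul1r.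
rewrite sumrB.
under [X in _ - (X - _)]eq_big_nat => j /andP[lej _].
  have -> : C (2 * j%:Z - 3) = C (x + 3 - (x + 2 * j%:Z)).
    have := C_opp_odd (j - 2); have -> : 2 * (j - 2)%:Z + 1 = 2 * j%:Z - 3 by lia.
    by move=> <-; congr C; lia.
  rewrite mulrC; over.
set S := \sum_(_ <= j < _) _ * _; set T := \sum_(_ <= j < _) h _.
have -> : forall a b c : R,
  a * (z * z + 1) + b * 1 + c * 1 + S - (a + b + c + T) - (S - T) = z * (z * a).
  by move=> a b c; ring.
by rewrite -mulrA !zmulK.
Qed.

Lemma mfw_formula_next : h m.+1 = nabla - h m - h m.+2
  - \sum_(3 <= j < (M - m).+1) h (m + j)%N.
Proof. by rewrite nabla_mfw; ring. Qed.

(** In the equation for k = x + 1 it is h_m and h_(m+1) that have the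
    coefficients C_1 = C_(-1) = 1. *)
Lemma mfw_formula_third : h m.+2 = zV * zV * (C (x + 1) - nabla
  - \sum_(3 <= j < (M - m).+1) (C (2 * j%:Z - 1) - 1) * h (m + j)%N).
Proof.
have := proj2 f_adm (x + 1); rewrite pairing_mfw.
have -> : x + 1 - x = 1 by lia.
have -> : x + 1 - (x + 2) = -1 by lia.
have -> : x + 1 - (x + 4) = -3 by lia.
rewrite CN3 C1 CN1 => <-; rewrite nabla_mfw.
under [X in _ - X]eq_bigr => j _ do rewrite mulrBl mul1r.
rewrite sumrB.
under [X in _ - (X - _)]eq_big_nat => j /andP[lej _].
  have -> : C (2 * j%:Z - 1) = C (x + 1 - (x + 2 * j%:Z)).
    have := C_opp_odd (j - 1); have -> : 2 * (j - 1)%:Z + 1 = 2 * j%:Z - 1 by lia.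
    by move=> <-; congr C; lia.
  rewrite mulrC; over.
set S := \sum_(_ <= j < _) _ * _; set T := \sum_(_ <= j < _) h _.
have -> : forall a b c : R,
  a * 1 + b * 1 + c * (z * z + 1) + S - (a + b + c + T) - (S - T) = z * (z * c).
  by move=> a b c; ring.
by rewrite -mulrA !zmulK.
Qed.

(** The equation for k = x reads 0 = C_x, whence x = 0, and then the one for
    k = 1 reads h_m = 1. *)
Lemma mfw_single : (forall k, C k = 0 -> k = 0) -> M = m -> f = 1.
Proof.
move=> C_eq0 eM.
have h1 : h m.+1 = 0 by apply: mfw_gt_max; rewrite eM.
have h2 : h m.+2 = 0 by apply: mfw_gt_max; rewrite eM; lia.
have noS (V : nmodType) (F : nat -> V) : \sum_(3 <= j < (M - m).+1) F j = 0.
  by rewrite big_geq // eM subnn.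
have fE := mfw_expansion; rewrite h1 h2 noS !mono0 !addr0 in fE.
have dE k : h m * C (k - x) = C k by rewrite -(proj2 f_adm k) fE pairing_mono.
have x0 : x = 0 by apply: C_eq0; rewrite -dE subrr C0 mulr0.
by have := dE 1; rewrite fE x0 subr0 C1 mulr1 => ->.
Qed.

Lemma mfw_pair : M = m.+1 -> f =
  laurent_monomial 1 x
  * (laurent_monomial (C (x + 2)) 0 - laurent_monomial 1 2 * laurent_monomial (C x) 0)
  * laurent_monomial zV 0.
Proof.
move=> eM.
have h2 : h m.+2 = 0 by apply: mfw_gt_max; rewrite eM.
have noS (V : nmodType) (F : nat -> V) : \sum_(3 <= j < (M - m).+1) F j = 0.
  by rewrite big_geq // eM subSn // subnn.
have fE := mfw_expansion; rewrite h2 noS !mono0 !addr0 in fE.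
have dE k : h m * C (k - x) + h m.+1 * C (k - (x + 2)) = C k.
  by rewrite -(proj2 f_adm k) fE pairingD !pairing_mono.
have := dE x; have -> : x - (x + 2) = -2 by lia.
rewrite subrr C0 mulr0 add0r CN2 => <-.
have := dE (x + 2); have -> : x + 2 - x = 2 by lia.
rewrite subrr C0 mulr0 addr0 C2 => <-.
rewrite fE monoM mulrBr !monoM mulrBl !monoM !addr0 !mul1r.
rewrite mulrN !mulNr -!mulrA [z * zV]mulrC zK !mulr1.
by rewrite /laurent_monomial monalgUN opprK.
Qed.

End MfwPolynomials.
End Specialization.

(** * The Homflypt polynomial of closed braids *)

Lemma vz_monomial : vpow 1 * (zpow 1)%:L = laurent_monomial (zpow 1) 1.
Proof. by rewrite /vpow monoM mul1r addr0. Qed.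

Lemma zpowNK : zpow (-1) * zpow 1 = 1.
Proof. by rewrite -zpowD. Qed.

Notation homflypt_admissible := (admissible Cpoly).

Section HomflyptOfClosures.
Variables (P : diagram -> Lvz) (HP : is_homflypt P).

Lemma closure_is_link_diagram n w : below n.-1 w -> is_link_diagram (closure n w).
Proof.
move=> bw; rewrite /is_link_diagram /closure run_cat run_cups /= run_cat.
by rewrite run_crossings //= run_caps.
Qed.

Lemma closure_move n A B w w' : local_move (crossings w) (crossings w') ->
    below n.-1 (A ++ w ++ B) -> below n.-1 (A ++ w' ++ B) ->
  P (closure n (A ++ w ++ B)) = P (closure n (A ++ w' ++ B)).
Proof.
move=> mv /closure_is_link_diagram + /closure_is_link_diagram.
rewrite /closure !crossings_cat -!catA !(catA (cups n)).
exact: (homflypt_invariant HP).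
Qed.

Lemma closure_skein n A B i b : below n.-1 (A ++ (i, b) :: B) ->
  P (closure n (A ++ (i, true) :: B)) =
    laurent_monomial (zpow 1) 1 * P (closure n (A ++ B))
    + laurent_monomial 1 2 * P (closure n (A ++ (i, false) :: B)).
Proof.
move=> bw; have /closure_is_link_diagram : below n.-1 (A ++ (i, true) :: B).
  by move: bw; rewrite !below_cat.
move: bw; rewrite below_cat => /andP[bA /andP[/= lti _]].
have rA : run [::] (cups n ++ crossings A) = Some (closure_level n).
  by rewrite run_cat run_cups /= run_crossings.
rewrite /closure !crossings_cat /= -!catA !(catA (cups n)) => link.
have := homflypt_skein HP rA link.
rewrite -vz_monomial /closure_level !nth_cat !size_nseq !nth_nseq.
by have [-> ->] : (i < n)%N /\ (i.+1 < n)%N by lia.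
Qed.

Lemma admissible_skein_closed n : skein_closed (fun w =>
  below n.-1 w -> homflypt_admissible n (word_writhe w) (P (closure n w))).
Proof.
split=> A B i.
- move=> j b c ij G bw.
  have bw' : below n.-1 (A ++ [:: (i, b); (j, c)] ++ B).
    by move: bw; rewrite !below_cat /=; lia.
  have := G bw'; rewrite !word_writhe_cat !word_writhe_cons.
  rewrite (addrCA (if (i, b).2 then _ else _)).
  suff -> : P (closure n (A ++ [:: (i, b); (j, c)] ++ B))
    = P (closure n (A ++ [:: (j, c); (i, b)] ++ B)) by [].
  case/orP: ij => ij; last apply: esym.
    apply: closure_move => //.
    have := move_exchange i (j - i.+2) (Cross b) (Cross c).
    by rewrite /= -!addnA !add2n !addnS -!addSn subnKC.
  apply: closure_move => //.
  have := move_exchange j (i - j.+2) (Cross c) (Cross b).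
  by rewrite /= -!addnA !add2n !addnS -!addSn subnKC.
- move=> b G bw.
  have bw' : below n.-1 (A ++ B) by move: bw; rewrite !below_cat /=; lia.
  have -> : P (closure n (A ++ [:: (i, b); (i, ~~ b)] ++ B))
    = P (closure n (A ++ [::] ++ B)).
    by apply: closure_move => //; apply: move_R2.
  have := G bw'; rewrite !word_writhe_cat !word_writhe_cons /word_writhe big_nil.
  by case: (b); rewrite /= addr0 ?subrr ?addNr add0r.
- move=> b1 b2 b3 b123 G bw.
  have bw' : below n.-1 (A ++ [:: (i, b1); (i.+1, b2); (i, b3)] ++ B).
    by move: bw; rewrite !below_cat /=; lia.
  have <- : P (closure n (A ++ [:: (i, b1); (i.+1, b2); (i, b3)] ++ B))
    = P (closure n (A ++ [:: (i.+1, b3); (i, b2); (i.+1, b1)] ++ B)).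
    by apply: closure_move => //; apply: move_R3.
  have := G bw'; rewrite !word_writhe_cat !word_writhe_cons /word_writhe big_nil.
  set s := (X in admissible _ n X _ -> _); set s' := (X in _ -> admissible _ n X _).
  by have -> : s = s' by rewrite /s /s' /=; ring.
move=> b Gswitch Gsmooth bw; have skein := closure_skein bw.
have bw' : below n.-1 (A ++ (i, ~~ b) :: B) by move: bw; rewrite !below_cat.
have bw0 : below n.-1 (A ++ B) by move: bw; rewrite !below_cat /=; lia.
have adm0 := Gsmooth bw0; have := Gswitch bw'.
have wE c : word_writhe (A ++ (i, c) :: B) = word_writhe (A ++ B) + (if c then 1 else -1).
  by rewrite !word_writhe_cat word_writhe_cons /=; ring.
rewrite !wE; case: b {bw bw' Gswitch} => /= admb.
  exact: (admissible_pos Cpoly_rec skein adm0 admb).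
exact: (admissible_neg Cpoly_rec skein admb adm0).
Qed.

(** Conjugation by a word, one letter at a time. *)
Lemma closure_rotation n u v : below n.-1 (u ++ v) ->
  P (closure n (u ++ v)) = P (closure n (v ++ u)).
Proof.
elim: u v => [|[i b] u IH] v; first by rewrite cats0.
move=> /= /andP[/= lti buv]; rewrite -(conjugation HP) // rcons_cat IH ?cat_rcons //.
by move: buv; rewrite -cats1 !below_cat /= lti !andbT.
Qed.

(** Induction on the number of strands.  A word with one letter n is conjugate
    to a stabilization; a word without it is the smoothing of two. *)
Lemma homflypt_closure_admissible n w : (0 < n)%N -> below n.-1 w ->
  homflypt_admissible n (word_writhe w) (P (closure n w)).
Proof.
elim: n w => // -[_ [|//] _ _|n IH w _ bw].
  by rewrite /word_writhe big_nil [P _](homflypt_unknot HP); apply: (admissible1 Cpoly).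
have one u b : below n u ->
  homflypt_admissible n.+2 (word_writhe u + (if b then 1 else -1))
    (P (closure n.+2 (rcons u (n, b)))).
  move=> bu; rewrite (@stabilization _ HP n.+1 u b) //.
  by apply: admissible_stabilization; apply: IH.
have below1 u : below n u -> below n.+1 u by apply: below_leq.
apply: (@skein_reduction n _ (admissible_skein_closed n.+2) _ _ w bw bw).
  move=> u bu _.
  have bu1 : below n.+2.-1 (u ++ [:: (n, true)]) by rewrite below_cat /= below1 ?ltnSn.
  have := closure_skein bu1; rewrite cats0 !cats1 => skein.
  exact: (admissible_smoothing zpowNK Cpoly_rec skein (one u true bu) (one u false bu)).
move=> u b u' bu bu' bub; rewrite (closure_rotation bub) /=.
rewrite (@closure_rotation _ [:: (n, b)]); last first.
  by rewrite /= ltnSn below_cat !below1.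
rewrite cats1 word_writhe_cat word_writhe_cons addrCA -word_writhe_cat addrC.
have := one (u' ++ u) b; rewrite below_cat bu' bu => /(_ erefl).
by rewrite !word_writhe_cat [word_writhe u + _]addrC.
Qed.

End HomflyptOfClosures.

Definition braid_letters n (beta : braid_word n) : word :=
  [seq (val g.1, g.2) | g <- beta].

Lemma braid_closureE n (beta : braid_word n) :
  braid_closure beta = closure n (braid_letters beta).
Proof. by rewrite /closure /crossings /braid_letters -map_comp. Qed.

Lemma below_braid n (beta : braid_word n) : below n.-1 (braid_letters beta).
Proof. by rewrite /below all_map; apply/allP => g _ /=. Qed.

Lemma writheE n (beta : braid_word n) : writhe beta = word_writhe (braid_letters beta).
Proof. by rewrite /word_writhe big_map. Qed.

Theorem corollary2p3 (P : diagram -> Lvz) (HP : is_homflypt P)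
    (n : nat) (hn : (1 <= n)%N) (beta : braid_word n) (m M : nat) (x : int)
    (hm : is_min_index (mfw P beta) m) (hM : is_max_index (mfw P beta) M)
    (hx : is_mindeg (P (braid_closure beta)) x) :
  let h := mfw P beta in
  let nabla := conway P (braid_closure beta) in
  let formula_i := h m = zpow (-2) * (Cpoly (x + 3) - nabla
      - \sum_(3 <= j < (M - m).+1) (Cpoly (2 * j%:Z - 3) - 1) * h (m + j)%N) in
  let formula_ii := h m.+1 = nabla - h m - h m.+2
      - \sum_(3 <= j < (M - m).+1) h (m + j)%N in
  let rhs_iii := zpow (-2) * (Cpoly (x + 1) - nabla
      - \sum_(3 <= j < (M - m).+1) (Cpoly (2 * j%:Z - 1) - 1) * h (m + j)%N) in
  [/\ (m + 2 <= M)%N -> [/\ formula_i, formula_ii & h m.+2 = rhs_iii],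
      (M < m + 2)%N -> [/\ formula_i, formula_ii & 0 = rhs_iii],
      M = m -> P (braid_closure beta) = 1
    & M = m.+1 ->
      P (braid_closure beta) =
        vpow x * ((Cpoly (x + 2))%:L - vpow 2 * (Cpoly x)%:L) * (zpow (-1))%:L].
Proof.
move=> h nabla formula_i formula_ii rhs_iii.
have adm : homflypt_admissible n (writhe beta) (P (braid_closure beta)).
  rewrite braid_closureE writheE.
  exact: homflypt_closure_admissible HP _ _ hn (below_braid beta).
have [hm0 min_m] := hm; have [hM0 max_M] := hM.
have zpow2 : zpow (-2) = zpow (-1) * zpow (-1) by rewrite -zpowD.
have i : formula_i.
  rewrite /formula_i zpow2.
  exact: (mfw_formula_min zpowNK Cpoly0 Cpoly1 Cpoly_rec adm hm0 min_m hM0 max_M hx).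
have ii : formula_ii by exact: (mfw_formula_next adm hm0 min_m hM0 max_M hx).
have iii : h m.+2 = rhs_iii.
  rewrite /rhs_iii zpow2.
  exact: (mfw_formula_third zpowNK Cpoly0 Cpoly1 Cpoly_rec adm hm0 min_m hM0 max_M hx).
split=> [_|ltM|eM|eM]; first by split.
- have h0 : h m.+2 = 0.
    by apply: (mfw_gt_max max_M); rewrite -addn2.
  by split; [exact: i | exact: ii | exact: etrans (esym h0) iii].
- exact: (mfw_single Cpoly0 Cpoly1 adm hm0 min_m hM0 max_M hx Cpoly_eq0 eM).
exact: (mfw_pair zpowNK Cpoly0 Cpoly1 Cpoly_rec adm hm0 min_m hM0 max_M hx eM).
Qed.
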